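(* There exists a constant $c\ge 1$ such that for every positive integer $r'$ there exist integers $n'$ and $r\ge r'$ such that for every integer $n\ge n'$ there exists a connected graph $G$ with $n$ vertices and rank-width $r$ satisfying $\Gamma_{\mathrm{CZ}}(|G\rangle)\le n-1+c(r-1)$.
   Context: Graphs are finite, simple and undirected. The Pauli group $\mathcal{G}_n$ consists of all $\alpha h_1\otimes\dots\otimes h_n$ with $\alpha\in\{\pm1,\pm i\}$, $h_j\in\{I_2,X,Y,Z\}$. The $n$-qubit Clifford group is $\mathcal{C}_n=\{U\in U(2^n): U\mathcal{G}_nU^\dagger=\mathcal{G}_n\}$. For a graph $G=(V,E)$ with $V=\{1,\dots,n\}$, the graph state $|G\rangle$ is the $n$-qubit state (unique up to global phase) that is fixed by $X_v\otimes\bigotimes_{w\in N_G(v)}Z_w$ for all $v\in V$. States are considered up to global phase. CZ-complexity: a quantum algorithm consists of (1) measurements of qubits in the computational basis (measured qubits are discarded); (2) single-qubit Clifford operations; (3) two-qubit Clifford operations (elements of $\mathcal{C}_2$ applied to any pair of qubits); later operations may depend on earlier measurement outcomes. Its CZ-complexity is the maximum, over measurement outcomes, of the number of two-qubit Clifford operations. $\Gamma_{\mathrm{CZ}}(|G\rangle)$ is the minimum CZ-complexity of an algorithm that generates $|G\rangle$ from $|0\rangle^{\otimes(n+s)}$ with probability $1$ for some $s\ge0$. Rank-width: for $S\subseteq V$, $\mathrm{cutrank}_G(S)$ is the rank over $\mathbb{F}_2$ of the $S\times(V\setminus S)$ submatrix of the adjacency matrix of $G$ (zero for $S=\varnothing$).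 A rank-decomposition of $G$ is a pair $(T,L)$ with $T$ a tree of maximum degree at most three with at least two vertices and $L$ a bijection from $V$ to the leaves of $T$. Each edge $e$ of $T$ induces a partition $\{S,V\setminus S\}$ of $V$ (via the leaves of the two components of $T-e$); the width of $e$ is $\mathrm{cutrank}_G(S)$, and the width of $(T,L)$ is the maximum width of its edges. The rank-width of $G$ is the minimum width over all rank-decompositions (and $0$ if $G$ has at most one vertex). *)

(* Defs.v *)
From HB Require Import structures.
From mathcomp Require Import all_boot all_order all_algebra.
From mathcomp Require Import reals complex.

Set Implicit Arguments.
Unset Strict Implicit.
Unset Printing Implicit Defensive.

Import Order.TTheory GRing.Theory Num.Theory.
Local Open Scope ring_scope.
Local Open Scope sesquilinear_scope.

Definition is_minimum (S : nat -> Prop) (k : nat) : Prop :=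
  S k /\ forall j : nat, S j -> (k <= j)%N.

Record simple_graph (V : finType) := SimpleGraph {
  adj :> rel V;
  adj_sym : symmetric adj;
  adj_irr : irreflexive adj }.

Definition connected_graph (V : finType) (G : simple_graph V) : Prop :=
  (0 < #|V|)%N /\ forall x y : V, connect G x y.

(* [ucycle] also accepts closed walks x, y of length two along a single edge,
   which are not cycles of an undirected graph. *)
Definition acyclic_graph (V : finType) (G : simple_graph V) : Prop :=
  forall p : seq V, ucycle G p -> (size p <= 2)%N.

Definition is_tree (V : finType) (G : simple_graph V) : Prop :=
  connected_graph G /\ acyclic_graph G.

Definition degree (V : finType) (G : simple_graph V) (x : V) : nat :=
  #|[set y | G x y]|.

Definition cutrank (V : finType) (G : simple_graph V) (S : {set V}) : nat :=
  \rank (\matrix_(i < #|S|, j < #|~: S|)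
           (G (enum_val i) (enum_val j))%:R : 'M['F_2]_(#|S|, #|~: S|)).

Definition rank_decomposition (V W : finType) (T : simple_graph W)
    (L : V -> W) : Prop :=
  [/\ is_tree T, (2 <= #|W|)%N, forall t : W, (degree T t <= 3)%N,
      injective L & forall t : W, (t \in codom L) = (degree T t == 1%N)].

Definition delete_edge (W : finType) (T : simple_graph W) (a b : W) : rel W :=
  [rel x y | T x y && ([set x; y] != [set a; b])].

(* The part, containing the side of a, of the partition of V induced by the
   edge ab. *)
Definition edge_side (V W : finType) (T : simple_graph W) (L : V -> W)
    (a b : W) : {set V} :=
  [set v | connect (delete_edge T a b) a (L v)].

Definition decomposition_width (V W : finType) (G : simple_graph V)
    (T : simple_graph W) (L : V -> W) : nat :=
  (\max_(e : W * W | T e.1 e.2) cutrank G (edge_side T L e.1 e.2))%N.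

Definition is_rank_width (V : finType) (G : simple_graph V) (r : nat) : Prop :=
  if (#|V| <= 1)%N then r = 0%N else
  is_minimum (fun w : nat =>
    exists (W : finType) (T : simple_graph W) (L : V -> W),
      rank_decomposition T L /\ decomposition_width G T L = w) r.

(* The computational basis of m qubits is indexed by [bits m]; since matrices
   are indexed by ordinals, operators and state vectors have dimension
   #|bits m| = 2 ^ m and their entries are read through
   [bit] and [enum_rank]. *)
Notation bits m := {ffun 'I_m -> 'I_2}.
Notation dim m := #|{: bits m}|.
Notation state C m := 'cV[C]_(dim m).
Notation oper C m := 'M[C]_(dim m).

Definition bit (m : nat) (x : 'I_(dim m)) : bits m := enum_val x.

Section Quantum.
Variable C : numClosedFieldType.

Definition tensor (m : nat) (h : 'I_m -> 'M[C]_2) : oper C m :=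
  \matrix_(x, y) \prod_(j < m) h j (bit x j) (bit y j).

Definition pauliX : 'M[C]_2 := \matrix_(i, j) (i != j)%:R.
Definition pauliZ : 'M[C]_2 :=
  \matrix_(i, j) if i == j then (-1) ^+ (val i) else 0.
Definition pauliY : 'M[C]_2 :=
  \matrix_(i, j) if i == j then 0 else if i == 0 then - 'i else 'i.

Definition pauli_group (m : nat) (P : oper C m) : Prop :=
  exists (alpha : C) (h : 'I_m -> 'M[C]_2),
    [/\ alpha \in [:: 1; -1; 'i; - 'i],
        forall j : 'I_m, h j \in [:: 1%:M; pauliX; pauliY; pauliZ]
      & P = alpha *: tensor h].

Definition clifford (m : nat) (U : oper C m) : Prop :=
  U \is unitarymx /\
  forall P : oper C m,
    pauli_group P <-> exists2 Q, pauli_group Q & P = U *m Q *m U ^t*.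

Definition norm2 (m : nat) (psi : state C m) : C :=
  \sum_(x < dim m) `|psi x 0| ^+ 2.

Definition graph_stabilizer (n : nat) (G : simple_graph 'I_n) (v : 'I_n) :
    oper C n :=
  tensor (fun w => if w == v then pauliX
                   else if G v w then pauliZ else 1%:M).

Definition is_graph_state (n : nat) (G : simple_graph 'I_n) (psi : state C n) :
    Prop :=
  norm2 psi = 1 /\ forall v : 'I_n, graph_stabilizer G v *m psi = psi.

Definition zero_state (m : nat) : state C m :=
  \col_x (bit x == [ffun _ => 0])%:R.

(* U acting on the qubits f 0, ..., f (k - 1), in this order, and trivially on
   the other ones (f is meant to be injective). *)
Definition on_qubits (k m : nat) (f : 'I_k -> 'I_m) (U : oper C k) :
    oper C m :=
  \matrix_(x, y)
    if [forall j, (j \notin codom f) ==> (bit x j == bit y j)]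
    then U (enum_rank [ffun i => bit x (f i)])
           (enum_rank [ffun i => bit y (f i)])
    else 0.

Definition insert_bit (m : nat) (j : 'I_m.+1) (b : 'I_2) (y : bits m) :
    bits m.+1 :=
  [ffun i => if unlift j i is Some i' then y i' else b].

(* Measurement of qubit j with outcome b. The remaining qubits are renumbered
   in increasing order; [collapse] is the unnormalized resulting state, whose
   squared norm is the probability of the outcome. *)
Definition collapse (m : nat) (j : 'I_m.+1) (b : 'I_2) (psi : state C m.+1) :
    state C m :=
  \col_y psi (enum_rank (insert_bit j b (bit y))) 0.

Definition outcome_prob (m : nat) (j : 'I_m.+1) (b : 'I_2)
    (psi : state C m.+1) : C := norm2 (collapse j b psi).

Definition post_measurement (m : nat) (j : 'I_m.+1) (b : 'I_2)
    (psi : state C m.+1) : state C m :=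
  (sqrtC (outcome_prob j b psi))^-1 *: collapse j b psi.

(* [algorithm n m] is the type of algorithms turning m qubits into n qubits.
   The continuation of a measurement is a function of its outcome. *)
Inductive algorithm (n : nat) : nat -> Type :=
| Done : algorithm n n
| Measure (m : nat) (j : 'I_m.+1) (A : 'I_2 -> algorithm n m) :
    algorithm n m.+1
| Gate1 (m : nat) (j : 'I_m) (U : oper C 1) (hU : clifford U)
    (A : algorithm n m) : algorithm n m
| Gate2 (m : nat) (j k : 'I_m) (hjk : j != k) (U : oper C 2)
    (hU : clifford U) (A : algorithm n m) : algorithm n m.

Fixpoint cz_complexity (n m : nat) (A : algorithm n m) : nat :=
  match A with
  | Done => 0%N
  | Measure _ _ A' => (\max_(b : 'I_2) cz_complexity (A' b))%N
  | Gate1 _ _ _ _ A' => cz_complexity A'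
  | Gate2 _ _ _ _ _ _ A' => (cz_complexity A').+1
  end.

(* On input psi, every sequence of outcomes of positive probability leads to
   phi, up to global phase. *)
Fixpoint generates (n m : nat) (phi : state C n) (A : algorithm n m) :
    state C m -> Prop :=
  match A in algorithm _ m return state C m -> Prop with
  | Done => fun psi => exists2 alpha : C, `|alpha| = 1 & psi = alpha *: phi
  | Measure _ j A' => fun psi =>
      forall b : 'I_2, outcome_prob j b psi != 0 ->
        generates phi (A' b) (post_measurement j b psi)
  | Gate1 _ j U _ A' => fun psi =>
      generates phi A' (on_qubits (fun _ : 'I_1 => j) U *m psi)
  | Gate2 _ j k _ U _ A' => fun psi =>
      generates phi A'
        (on_qubits (fun i : 'I_2 => if i == 0 then j else k) U *m psi)
  end.

(* Measurement outcomes of probability zero also enter [cz_complexity]; this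
   does not affect the minimum, as the corresponding branches may be replaced
   by ones without two-qubit operations. *)
Definition is_GammaCZ (n : nat) (phi : state C n) (g : nat) : Prop :=
  is_minimum (fun k : nat =>
    exists (s : nat) (A : algorithm n (n + s)),
      generates phi A (zero_state (n + s)) /\ cz_complexity A = k) g.

End Quantum.

(* Main.v *)
(** A random graph with d N edges on a core of N = 8 k vertices has, with
    positive probability, an edge between any two sets of k core vertices.  Join
    core vertex 0 to all other vertices of a graph on n >= N vertices: it has at
    most n - 1 + d N edges, and a circuit with one CZ per edge prepares its graph
    state.  Every rank-decomposition has an edge splitting the core evenly up to
    constants, and sparsity and density force the cut-rank there to be at least
    k / D with D independent of k.  Adding one more pendant vertex at 0 amounts
    to giving the leaf of 0 two new leaves, so the rank-width does not increase
    with n; being at least k / D it is eventually constant. *)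

Require Import Defs.
From mathcomp Require Import all_boot all_order all_algebra.
From mathcomp Require Import reals complex.
From mathcomp Require Import boolp zify ring.

Set Implicit Arguments.
Unset Strict Implicit.
Unset Printing Implicit Defensive.

Import Order.TTheory GRing.Theory Num.Theory.

(** * Sparse graphs without large empty pairs *)

Lemma card_bigcup_le (I T : finType) (P : pred I) (F : I -> {set T}) :
  (#|\bigcup_(i | P i) F i| <= \sum_(i | P i) #|F i|)%N.
Proof.
apply: (@big_ind2 _ _ (fun (A : {set T}) m => #|A| <= m)%N) => [|A a B b hA hB|//].
  by rewrite cards0.
by apply: leq_trans (leq_add hA hB); rewrite -cardsUI leq_addr.
Qed.

(** The first two terms of the binomial expansion of the right-hand side are both equal to
    [m ^ m]. *)
Lemma leq_double_expn_succ (m : nat) : (0 < m -> 2 * m ^ m <= m.+1 ^ m)%N.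
Proof.
case: m => // m _; rewrite -[m.+2]addn1 expnDn.
rewrite big_ord_recl big_ord_recl /= /bump /= !addn0 bin0 bin1 !mul1n subn0.
by rewrite subSS subn0 !exp1n !muln1 -expnS mul2n -addnn addnA leq_addr.
Qed.

(* A pair of sets of at least k of the N = 8 k points is missed by a uniform
   pair of points with probability at most 63/64, hence by d N independent ones
   with probability less than 4 ^ - N. *)
Lemma random_edges :
  exists d : nat, forall k : nat, (0 < k)%N ->
  exists e : {ffun 'I_(d * (8 * k)) -> 'I_(8 * k) * 'I_(8 * k)},
  forall A B : {set 'I_(8 * k)}, (k <= #|A|)%N -> (k <= #|B|)%N ->
  exists m, (e m).1 \in A /\ (e m).2 \in B.
Proof.
have [d ltd] : exists d, (4 * 63 ^ d < 64 ^ d)%N.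
  suff ex m : (0 < m -> exists d, 4 * m ^ d < m.+1 ^ d)%N by exact: ex.
  (* Since (1 + 1/m)^m is at least 2, its cube is at least 8, which exceeds 4. *)
  move=> m0; exists (m * 3)%N; rewrite !expnM.
  apply: (@leq_trans ((2 * m ^ m) ^ 3)); last first.
    by rewrite leq_exp2r // leq_double_expn_succ.
  by rewrite expnMn ltn_mul2r !expn_gt0 m0.
exists d => k k0; set N := (8 * k)%N; set M := (d * N)%N.
have N0 : (0 < N)%N by rewrite muln_gt0.
have d0 : (0 < d)%N by case: (d) ltd.
have M0 : (0 < M)%N by rewrite muln_gt0 d0.
pose big (p : {set 'I_N} * {set 'I_N}) := (k <= #|p.1|)%N && (k <= #|p.2|)%N.
pose avoid (p : {set 'I_N} * {set 'I_N}) :=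
  [set e : {ffun 'I_M -> 'I_N * 'I_N} | e \in ffun_on (mem (~: setX p.1 p.2))].
have avoid_le p : big p -> (#|avoid p| <= (63 * (k * k)) ^ M)%N.
  case/andP=> h1 h2; rewrite cardsE card_ffun_on card_ord leq_exp2r //.
  have := cardsC (setX p.1 p.2); rewrite cardsX card_prod !card_ord.
  have := leq_mul h1 h2.
  rewrite /N; move: (#|p.1| * #|p.2|)%N #|~: _| => a b.
  clear ltd; lia.
have lt_bad : (#|\bigcup_(p | big p) avoid p| < #|{: {ffun 'I_M -> 'I_N * 'I_N}}|)%N.
  rewrite card_ffun card_prod !card_ord.
  apply: (@leq_ltn_trans (\sum_(p | big p) #|avoid p|)).
    exact: card_bigcup_le.
  (* Union bound: each of the 4 ^ N pairs of sets is charged the bound for a big pair. *)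
  apply: (@leq_ltn_trans (\sum_(p : {set 'I_N} * {set 'I_N}) (63 * (k * k)) ^ M)).
    rewrite [X in (_ <= X)%N](bigID big) /=; apply: leq_trans (leq_addr _ _).
    exact: leq_sum.
  rewrite sum_nat_const card_prod -cardsT -powersetT card_powerset cardsT card_ord -expnMn.
  have -> : (N * N = 64 * (k * k))%N by clear ltd; rewrite /N; lia.
  rewrite !(expnMn _ (k * k)) mulnA ltn_pmul2r ?expn_gt0 ?muln_gt0 ?k0 //.
  by rewrite /M !(expnM _ d) -expnMn (ltn_exp2r _ _ N0).
have /subsetPn [e _ ebad] :
    ~~ ([set: {ffun 'I_M -> 'I_N * 'I_N}] \subset \bigcup_(p | big p) avoid p).
  by apply/negP=> /subset_leq_card; rewrite cardsT leqNgt lt_bad.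
exists e => A B hA hB.
have : e \notin avoid (A, B).
  by apply: contra ebad => h; apply/bigcupP; exists (A, B); rewrite // /big hA.
rewrite inE => /ffun_onP h.
case: (pickP (fun m => ((e m).1 \in A) && ((e m).2 \in B))) => [m /andP[]|none].
  by exists m.
by case: h => m; rewrite !inE none.
Qed.

(** * Trees *)

Lemma eq_set2 (T : finType) (x y a b : T) :
  ([set x; y] == [set a; b]) = (x == a) && (y == b) || (x == b) && (y == a).
Proof.
apply/idP/idP; last by case/orP=> /andP[/eqP-> /eqP->]; rewrite // setUC.
move=> /eqP E.
have : x \in [set a; b] by rewrite -E set21.
have : y \in [set a; b] by rewrite -E set22.
have : a \in [set x; y] by rewrite E set21.
have : b \in [set x; y] by rewrite E set22.
rewrite !inE => /orP[] /eqP Ea /orP[] /eqP Eb /orP[] /eqP Ey /orP[] /eqP Ex;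
  by subst; rewrite ?eqxx ?orbT //; subst; rewrite ?eqxx ?orbT.
Qed.

Lemma connect_invariant (W : finType) (e : rel W) (P : pred W) (a x : W) :
  P a -> (forall y z, connect e a y -> P y -> e y z -> P z) -> connect e a x -> P x.
Proof.
move=> Pa step /connectP [p pth ->].
elim: p a Pa step pth => //= b p IH a Pa step /andP[ab pth].
apply: IH => //; first exact: step ab.
by move=> y z bz; apply: step; apply: connect_trans (connect1 ab) bz.
Qed.

Section Tree.
Variables (W : finType) (T : simple_graph W).
Hypothesis treeT : is_tree T.

(** The component of a in T minus the edge ab; [edge_side T L a b] is its preimage under [L]. *)
Definition branch (a b : W) : pred W := connect (delete_edge T a b) a.

Lemma delete_edgeP (a b x y : W) : T x y ->
  delete_edge T a b x y \/ (x = a /\ y = b) \/ (x = b /\ y = a).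
Proof.
rewrite /delete_edge /= => Txy; rewrite Txy /=.
case E: (_ == _); last by left.
by right; move: E; rewrite eq_set2 => /orP[] /andP[/eqP-> /eqP->]; [left|right].
Qed.

Lemma branch0 a b : branch a b a. Proof. exact: connect0. Qed.

Lemma branch_step a b x y : branch a b x -> T x y ->
  [\/ branch a b y, x = a /\ y = b | x = b /\ y = a].
Proof.
move=> hx /(@delete_edgeP a b) [h|[h|h]]; first last.
- by apply: Or33.
- by apply: Or32.
by apply: Or31; apply: connect_trans hx (connect1 h).
Qed.

Lemma delete_edgeC a b : delete_edge T a b =2 delete_edge T b a.
Proof. by move=> x y; rewrite /delete_edge /= (setUC [set a]). Qed.

(** A repetition-free path from a to b avoiding the edge ab would close up with that edge to a cycle
    of length at least three. *)
Lemma branch_excl (a b : W) : T a b -> ~~ branch a b b.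
Proof.
move=> Tab; apply/negP=> /connectP[p0 pth0 E0].
case/shortenP: pth0 E0 => p pth up _ E.
have nab : a != b by apply/eqP=> ab; move: Tab; rewrite ab adj_irr.
have pT : path T a p by apply: sub_path pth => x y /andP[].
have : (size (a :: p) <= 2)%N.
  apply: (proj2 treeT); rewrite /ucycle [uniq _]up andbT /= rcons_path pT /=.
  by rewrite -E adj_sym.
case: p pth up E {pT} => [|x [|y p]] //=.
  by move=> _ _ E; rewrite E eqxx in nab.
by move=> /andP[/andP[_ /negP h] _] _ Eb; case: h; rewrite Eb.
Qed.

(** Along a walk from a, the current component can change only by crossing ab, and this leads to the
    other one. *)
Lemma branch_cover (a b x : W) : T a b -> branch a b x || branch b a x.
Proof.
move=> Tab.
apply: (@connect_invariant _ T (fun x => branch a b x || branch b a x) a).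
- by rewrite branch0.
- move=> y z _ /orP[] h Tyz; have [-> //|[_ ->]|[_ ->]] := branch_step h Tyz;
    rewrite ?branch0 ?orbT // => ->; rewrite ?orbT //.
- exact: (proj2 (proj1 treeT)).
Qed.

(** Induction along a walk from b: a step out of b enters the branch of a neighbour other than a,
    and this branch can be left only back to b. *)
Lemma branch_split (a b x : W) : branch b a x ->
  x = b \/ exists c, [/\ T b c, c != a & branch c b x].
Proof.
pose P x := (x == b) || [exists c, [&& T b c, c != a & branch c b x]].
suff : branch b a x -> P x.
  move=> h /h /orP[/eqP->|/existsP[c /and3P[]]]; first by left.
  by right; exists c.
apply: connect_invariant; first by rewrite /P eqxx.
move=> y z _ Py /andP[Tyz Eyz].
case/orP: Py => [/eqP Ey|/existsP[c /and3P[Tbc ca cy]]].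
  subst y; apply/orP; right; apply/existsP; exists z.
  by rewrite Tyz branch0 andbT /=; apply: contraNneq Eyz => ->.
have [h|[_ ->]|[_ ->]] := branch_step cy Tyz; rewrite /P ?eqxx //.
  by apply/orP; right; apply/existsP; exists c; rewrite Tbc ca.
by apply/orP; right; apply/existsP; exists c; rewrite Tbc ca branch0.
Qed.

(** The branch at c does not contain b, so walks inside it never use the edge ab; prefixing them
    with the edge bc gives walks from b. *)
Lemma branch_sub (a b c x : W) :
  T a b -> T b c -> c != a -> branch c b x -> branch b a x.
Proof.
move=> Tab Tbc ca.
have Tcb : T c b by rewrite adj_sym.
have nb := branch_excl Tcb.
have na : ~~ branch c b a.
  apply/negP=> h; have [h'|[E _]|[E _]] := branch_step h Tab.
  - by rewrite h' in nb.
  - by rewrite E eqxx in ca.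
  - by move: Tab; rewrite E adj_irr.
have step y z : y != b -> z != b -> T y z -> delete_edge T b a y z.
  move=> yb zb Tyz; have [//|[[E _]|[_ E]]] := delete_edgeP b a Tyz.
    by rewrite E eqxx in yb.
  by rewrite E eqxx in zb.
apply: connect_invariant => [|y z cy by_ yz].
  apply: connect1; have [//|[[_ E]|[E _]]] := delete_edgeP b a Tbc.
    by rewrite E eqxx in ca.
  by move: Tab; rewrite E adj_irr.
have cz : branch c b z := connect_trans cy (connect1 yz).
have /andP[Tyz _] := yz.
apply: connect_trans by_ (connect1 _); apply: step => //.
  by apply: contraNneq nb => E; rewrite -[X in branch _ _ X]E.
by apply: contraNneq nb => E; rewrite -[X in branch _ _ X]E.
Qed.

(** A common vertex would connect a to b without the edge ab. *)
Lemma branch_disjoint (a b x : W) : T a b -> branch a b x -> ~~ branch b a x.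
Proof.
move=> Tab ax; apply: contra (branch_excl Tab) => bx.
apply: connect_trans ax _; rewrite sym_connect_sym; last first.
  by move=> y z; rewrite /delete_edge /= adj_sym (setUC [set z]).
by rewrite (eq_connect (delete_edgeC a b)).
Qed.

End Tree.

(** Walk through the tree, always towards a side holding at least 2 k elements of [K], until the
    side behind holds that many too. The branch ahead shrinks at each step, so the walk ends. *)
Lemma balanced_edge (V W : finType) (T : simple_graph W) (L : V -> W)
    (K : {set V}) (k : nat) :
  rank_decomposition T L -> (0 < k)%N -> #|K| = (8 * k)%N ->
  exists a b : W, T a b /\ (2 * k <= #|K :&: edge_side T L a b|)%N /\
    (2 * k <= #|K :\: edge_side T L a b|)%N.
Proof.
case=> treeT W2 deg3 Linj _ k0 cK.

pose w a b := #|K :&: edge_side T L a b|.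
have sideC a b : T a b -> #|K :\: edge_side T L a b| = w b a.
  move=> Tab; apply: eq_card => v; rewrite !inE andbC; congr (_ && _).
  have := branch_cover treeT (L v) Tab; rewrite -!/(branch _ _ _ _).
  case ha: (branch T a b (L v)) => /=; last by move=> ->.
  by rewrite (negbTE (branch_disjoint treeT Tab ha)).
have wC a b : T a b -> (w a b + w b a = 8 * k)%N.
  by move=> Tab; rewrite -cK -(cardsID (edge_side T L a b) K) sideC.
suff [a [b [Tab [ha hb]]]] : exists a b, T a b /\ (2 * k <= w a b)%N /\ (2 * k <= w b a)%N.
  by exists a, b; rewrite sideC.
have descend m : forall a b, T a b -> (#|branch T b a| <= m)%N -> (2 * k <= w b a)%N ->
    exists a b, T a b /\ (2 * k <= w a b)%N /\ (2 * k <= w b a)%N.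
  elim: m => [|m IH] a b Tab.
    by rewrite leqn0 => /eqP /card0_eq /(_ b); rewrite inE branch0.
  move=> hm hw; case: (leqP (2 * k) (w a b)) => [ha|light]; first by exists a, b.
  pose N := [set c | T b c & c != a].
  have N2 : (#|N| <= 2)%N.
    rewrite -ltnS; apply: leq_trans (deg3 b).
    rewrite /degree (cardsD1 a [set y | T b y]) inE adj_sym Tab ltnS.
    by apply/subset_leq_card/subsetP=> c; rewrite !inE andbC.
  case: (pickP [pred c | (c \in N) && (2 * k <= w c b)%N]) => [c|none].
    rewrite /= inE => /andP[/andP[Tbc ca] wc].
    apply: (IH b c Tbc) wc; rewrite -ltnS; apply: leq_trans hm.
    apply: proper_card; apply/properP; split.
      by apply/subsetP=> x; apply: branch_sub.
    exists b; first exact: branch0.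
    by apply: branch_excl; rewrite // adj_sym.
  (* If no further neighbour of b has a heavy branch, the side of b holds at most 1 + 2 (2 k - 1)
     elements, the 1 being for b itself as a leaf; but the light side of a leaves more than 6 k. *)
  have : (w b a <= 1 + \sum_(c in N) w c b)%N.
    apply: (@leq_trans #|(K :&: [set v | L v == b]) :|:
                         \bigcup_(c in N) (K :&: edge_side T L c b)|).
      apply/subset_leq_card/subsetP=> v; rewrite !inE => /andP[vK /branch_split].
      rewrite vK /= => -[->|[c [Tbc ca cv]]]; first by rewrite eqxx.
      by apply/orP; right; apply/bigcupP; exists c; rewrite !inE ?Tbc ?vK.
    apply: leq_trans (leq_card_setU _ _) _.
    apply: leq_add.
      rewrite leqNgt; apply/negP=> /card_gt1P[u [v []]].
      rewrite !inE => /andP[_ /eqP uE] /andP[_ /eqP vE] /eqP; apply.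
      by apply: Linj; rewrite uE vE.
    exact: card_bigcup_le.
  have : (\sum_(c in N) w c b <= \sum_(c in N) (2 * k).-1)%N.
    apply: leq_sum => c cN; move: (none c); rewrite /= cN /=.
    by move: (w c b) => u; lia.
  rewrite sum_nat_const; have := wC _ _ Tab; move: N2.
  move: #|N| (\sum_(_ in _) _)%N (w b a) (w a b) light => p q r s; nia.
have [a0 [b0 Tab]] : exists a b, T a b.
  case/card_gt1P: W2 => x [y [_ _ xy]].
  have /connectP[[|z p] /= pth E] := proj2 (proj1 treeT) x y.
    by rewrite E eqxx in xy.
  by exists x, z; case/andP: pth.
(* The two sides of the starting edge hold 8 k elements together, so one of its two orientations
   points to a heavy side. *)
case: (leqP (2 * k) (w b0 a0)) => h; first exact: descend _ _ _ Tab (leqnn _) h.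
apply: (descend #|branch T a0 b0| b0 a0); rewrite ?leqnn // 1?adj_sym //.
by have := wC _ _ Tab; move: (w _ _) (w _ _) h => p q; lia.
Qed.

(** * Cut-rank *)

Section CutRank.
Local Open Scope ring_scope.

(** A factorization of the cut matrix through dimension m, with rows and columns indexed by vertices
    instead of ordinals, so that it can be carried to another graph. *)
Definition cut_factor (V : finType) (G : simple_graph V) (S : {set V}) (m : nat) :=
  exists P Q : V -> 'I_m -> 'F_2, forall x y, x \in S -> y \notin S ->
    (G x y)%:R = \sum_k P x k * Q y k.

(** This is the full-rank factorization of the matrix into [col_base] and [row_base], read on
    vertices and extended by zero to the wrong side of the cut. *)
Lemma cut_factor_cutrank (V : finType) (G : simple_graph V) (S : {set V}) :
  cut_factor G S (cutrank G S).
Proof.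
rewrite /cutrank; set A := \matrix_(_, _) _.
pose P x := if insub x : {? x | x \in S} is Some u then
   fun k => col_base A (enum_rank_in (valP u) x) k else fun=> 0.
pose Q y := if insub y : {? y | y \in ~: S} is Some u then
   fun k => row_base A k (enum_rank_in (valP u) y) else fun=> 0.
exists P, Q => x y xS yS.
have yS' : y \in ~: S by rewrite inE.
rewrite /P /Q !insubT /=.
set i := enum_rank_in _ x; set j := enum_rank_in _ y.
transitivity (A i j); first by rewrite mxE !enum_rankK_in.
by rewrite -{1}(mulmx_base A) mxE.
Qed.

Lemma cutrank_le_factor (V : finType) (G : simple_graph V) (S : {set V}) m :
  cut_factor G S m -> (cutrank G S <= m)%N.
Proof.
case=> P [Q PQ]; rewrite /cutrank.
pose B := \matrix_(i < #|S|, k < m) P (enum_val i) k.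
pose C := \matrix_(k < m, j < #|~: S|) Q (enum_val j) k.
have -> : (\matrix_(i < #|S|, j < #|~: S|)
           (G (enum_val i) (enum_val j))%:R : 'M['F_2]_(#|S|, #|~: S|)) = B *m C.
  apply/matrixP=> i j; rewrite !mxE PQ ?enum_valP //.
    by apply: eq_bigr => k _; rewrite !mxE.
  by have := enum_valP j; rewrite inE.
apply: leq_trans (mulmx_max_rank _ _) _; by [].
Qed.

Lemma cutrank_le_card (V : finType) (G : simple_graph V) (S : {set V}) :
  (cutrank G S <= #|S|)%N.
Proof. exact: rank_leq_row. Qed.

Lemma cutrank_le_cardC (V : finType) (G : simple_graph V) (S : {set V}) :
  (cutrank G S <= #|~: S|)%N.
Proof. exact: rank_leq_col. Qed.

(* Few rows of the cut matrix span all its light rows (those with less than D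
   ones), so all of these vanish outside the few columns in the support of the
   spanning rows; this would leave a k by k block without edges. *)
Lemma cutrank_lower_bound (V : finType) (G : simple_graph V) (K S : {set V})
    (k D : nat) :
  (forall A B : {set V}, A \subset K -> B \subset K -> [disjoint A & B] ->
     (k <= #|A|)%N -> (k <= #|B|)%N -> exists x y, [/\ x \in A, y \in B & G x y]) ->
  (#|[set p : V * V | [&& p.1 \in K, p.2 \in K & G p.1 p.2]]| < D * k)%N ->
  (2 * k <= #|K :&: S|)%N -> (2 * k <= #|K :\: S|)%N ->
  (k < D * cutrank G S)%N.
Proof.
move=> dense sparse cS cS'; rewrite ltnNge; apply/negP=> small.
pose deg x := #|[set y in K | G x y]|.
have sumdeg : (\sum_(x in K) deg x < D * k)%N.
  apply: leq_ltn_trans sparse; rewrite -sum1_card.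
  rewrite (eq_bigl (fun p : V * V => (p.1 \in K) && ((p.2 \in K) && G p.1 p.2)));
    last by move=> p; rewrite inE.
  rewrite -(pair_big_dep (fun x => x \in K) (fun x y => (y \in K) && G x y) (fun _ _ => 1%N)).
  apply: leq_sum => x _; rewrite sum1_card /deg.
  by apply/subset_leq_card/subsetP=> y; rewrite !inE.
pose heavy := [set x in K | (D <= deg x)%N].
have heavy_lt : (#|heavy| < k)%N.
  rewrite -(@ltn_pmul2l D); last by case: (D) sumdeg; rewrite ?mul0n ?ltn0.
  apply: leq_ltn_trans sumdeg; rewrite mulnC -sum_nat_const.
  rewrite [X in (_ <= X)%N](bigID (mem heavy)) /=; apply: leq_trans (leq_addr _ _).
  rewrite [X in (_ <= X)%N](eq_bigl (mem heavy)); last by move=> x /=; rewrite inE; case: (x \in K).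
  by apply: leq_sum => x; rewrite inE => /andP[].
set rho := cutrank G S in small.
pose A := (K :&: S) :\: heavy.
have Ak : (k <= #|A|)%N.
  have := cardsID heavy (K :&: S).
  have : (#|(K :&: S) :&: heavy| <= #|heavy|)%N by apply/subset_leq_card/subsetIr.
  by rewrite -/A; lia.
have [P [Q PQ]] := cut_factor_cutrank G S; rewrite -/rho in P Q PQ.
(* The spanning rows are chosen in the left factor, whose rows have length [rho]. So there are at
   most [rho] of them, each with fewer than D neighbours in [K], and [Y] has at most D [rho] <= k
   elements. *)
pose PA := \matrix_(i < #|A|, j < rho) P (enum_val i) j.
pose f := @maxrankfun _ _ _ PA.
pose Y := \bigcup_(i < \rank PA) [set y in K | G (enum_val (f i)) y].
have Alight x : x \in A -> [/\ x \in S, x \in K & (deg x < D)%N].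
  by rewrite !inE => /and3P[]; case: (x \in K); rewrite //= -ltnNge.
have Yle : (#|Y| <= k)%N.
  apply: leq_trans small; apply: leq_trans (card_bigcup_le _ _) _.
  apply: (@leq_trans (\sum_(i < \rank PA) D)).
    by apply: leq_sum => i _; case: (Alight _ (enum_valP (f i))) => _ _ /ltnW.
  by rewrite sum_nat_const card_ord mulnC leq_mul2l rank_leq_col orbT.
pose B := (K :\: S) :\: Y.
have Bk : (k <= #|B|)%N.
  have := cardsID Y (K :\: S).
  have : (#|(K :\: S) :&: Y| <= #|Y|)%N by apply/subset_leq_card/subsetIr.
  by rewrite -/B; lia.
have [||| x [y [xA yB Gxy]]] := dense A B _ _ _ Ak Bk.
- by apply/subsetP=> x /Alight[].
- by apply/subsetP=> x; rewrite !inE => /and3P[].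
- apply/pred0P => x /=; rewrite !inE; case: (x \in S); rewrite ?andbF //.
have [yY yS yK] : [/\ y \notin Y, y \notin S & y \in K].
  by move: yB; rewrite !inE => /and3P[].
have [xS xK _] := Alight _ xA.
have sub : (PA <= rowsub f PA)%MS by rewrite eq_maxrowsub.
have /submxP[M PAE] := sub.
(* As y lies outside [Y], [Q y] is orthogonal to the spanning rows of [PA], hence to all rows,
   including that of x; this contradicts [Gxy]. *)
have zero (i : 'I_(\rank PA)) : \sum_j P (enum_val (f i)) j * Q y j = 0.
  have fA := enum_valP (f i); have [fS fK _] := Alight _ fA.
  rewrite -PQ //; case Gf: (G _ y) => //; case/bigcupP: yY; exists i => //.
  by rewrite inE yK.
have /eqP : (G x y)%:R = 0 :> 'F_2.
  rewrite PQ //.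
  transitivity ((PA *m \col_j Q y j) (enum_rank_in xA x) 0).
    by rewrite mxE; apply: eq_bigr => j _; rewrite !mxE enum_rankK_in.
  rewrite PAE -mulmxA (_ : rowsub f PA *m _ = 0) ?mulmx0 ?mxE //.
  apply/matrixP=> i j; rewrite [RHS]mxE mxE; apply: etrans (zero i).
  by apply: eq_bigr => l _; rewrite !mxE.
by rewrite Gxy.
Qed.

End CutRank.

(** * Rank-decompositions and pendant vertices *)

Section Attach.
Variables (W : finType) (T : simple_graph W) (t : W).

(** Two new leaves are hung on t. When t is the leaf of v, it becomes an inner vertex: [inr false]
    takes over v and [inr true] receives the new vertex. *)
Definition attach_rel : rel (W + bool) := fun u v =>
  match u, v with
  | inl a, inl b => T a b
  | inl a, inr _ | inr _, inl a => a == t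
  | inr _, inr _ => false
  end.

Lemma attach_sym : symmetric attach_rel.
Proof. by move=> [a|a] [b|b] //=; apply: adj_sym. Qed.

Lemma attach_irr : irreflexive attach_rel.
Proof. by move=> [a|a] //=; apply: adj_irr. Qed.

Definition attach : simple_graph _ := SimpleGraph attach_sym attach_irr.

Definition attach_proj (u : W + bool) : W := if u is inl a then a else t.

Lemma degree_attach u :
  degree attach u = if u is inl a then (degree T a + 2 * (a == t))%N else 1%N.
Proof.
rewrite /degree -sum1_card big_sumType /=.
case: u => [a|b].
  rewrite -[in RHS]sum1_card; congr (_ + _)%N.
    by apply: eq_bigl => y; rewrite !inE.
  by rewrite big_mkcond big_bool /= !inE /=; case: (a == t).
rewrite (big_pred1 t) => [|y]; last by rewrite !inE.
by rewrite big1 // => y; rewrite inE.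
Qed.

Lemma connect_attach_inl (e : rel (W + bool)) (e' : rel W) a b :
  (forall x y, e' x y -> e (inl x) (inl y)) ->
  connect e' a b -> connect e (inl a) (inl b).
Proof.
move=> ee' ab; pose P w := connect e (inl a) (inl w).
apply: (@connect_invariant _ e' P a b) ab => [|y z _ ay yz]; first exact: connect0.
by apply: connect_trans ay (connect1 (ee' _ _ yz)).
Qed.

(** A cycle of length at least three through a new leaf would visit its only neighbour t twice, and
    a cycle through no new leaf is a cycle of [T]. *)
Lemma attach_tree : is_tree T -> is_tree attach.
Proof.
case=> [[W0 conT] acyT]; split; first split.
- by apply/card_gt0P; exists (inl t).
- have tot u : connect attach (inl t) u.
    case: u => [a|b]; last by apply: connect1; rewrite /= eqxx.
    by apply: connect_attach_inl (conT t a).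
  move=> x y; apply: connect_trans (tot y).
  by rewrite sym_connect_sym // => ? ?; apply: adj_sym.
move=> p /andP[cyc up].
case: (boolP (has (fun u => if u is inr _ then true else false) p)) => [/hasP[[//|b] bp _]|].
  have [i q Eq] := rot_to bp.
  rewrite -(size_rot i) Eq; move: cyc up; rewrite -(rot_cycle i) -(rot_uniq i) Eq.
  case: q {Eq} => [|x q] // cyc /andP[_ /andP[xq _]].
  case/lastP: q cyc xq => [|q y] //=.
  rewrite !rcons_path last_rcons mem_rcons inE /=.
  case: x => // x /andP[/eqP -> /andP[_]]; case: y => // y /eqP ->.
  by rewrite eqxx.
move=> none; have Ep : p = map inl (map attach_proj p).
  rewrite -map_comp -[LHS]map_id; apply/eq_in_map => -[a|b] //= bp.
  by case/hasP: none; exists (inr b).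
rewrite Ep size_map; apply: acyT; rewrite /ucycle.
move: cyc up; rewrite {1 2}Ep cycle_map map_inj_uniq; last by move=> ? ? [].
by move=> h ->; rewrite andbT.
Qed.

Variables (n : nat) (L : 'I_n -> W) (v : 'I_n).
Hypotheses (rdT : rank_decomposition T L) (tE : t = L v).

Definition attach_leaf (i : 'I_n.+1) : W + bool :=
  if unlift ord_max i is Some j then
    if j == v then inr false else inl (L j)
  else inr true.

Definition merge_vertex (i : 'I_n.+1) : 'I_n := odflt v (unlift ord_max i).

Lemma attach_leaf_proj i : attach_proj (attach_leaf i) = L (merge_vertex i).
Proof.
rewrite /attach_leaf /merge_vertex; case: unliftP => [j _|_] //=.
by case: eqP => [->|].
Qed.

Lemma attach_leaf_inj : injective attach_leaf.
Proof.
have [_ _ _ Linj _] := rdT.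
move=> i i'; rewrite /attach_leaf.
case: unliftP => [j ->|->]; case: unliftP => [j' ->|->] //;
  repeat case: eqP => //; first by move=> -> ->.
by move=> _ _ [/Linj ->].
Qed.

(** The former leaf t gets degree three, and it also stops carrying a vertex since v moves to
    [inr false]; other old vertices of the tree keep their degree. *)
Lemma attach_decomposition : rank_decomposition attach attach_leaf.
Proof.
have [treeT W2 deg3 Linj Lleaf] := rdT.
have degt : degree T t = 1%N by apply/eqP; rewrite -Lleaf tE codom_f.
split.
- exact: attach_tree.
- by rewrite card_sum card_bool addn2.
- move=> [a|b]; rewrite degree_attach //.
  by case: eqP => [->|_]; rewrite ?degt // muln0 addn0.
- exact: attach_leaf_inj.
move=> [a|b]; rewrite degree_attach; last first.
  rewrite eqxx; apply/codomP; case: b.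
    by exists ord_max; rewrite /attach_leaf unlift_none.
  by exists (lift ord_max v); rewrite /attach_leaf liftK eqxx.
case: (a =P t) => [->|/eqP at_]; rewrite ?degt.
  apply/negbTE/codomP => -[ i]; rewrite /attach_leaf.
  case: unliftP => // j _; case: eqP => // /eqP jv [/eqP].
  by rewrite tE (inj_eq Linj) eq_sym (negbTE jv).
rewrite muln0 addn0 -Lleaf; apply/codomP/codomP => -[].
  move=> i; rewrite /attach_leaf; case: unliftP => // j _.
  by case: eqP => // _ [->]; exists j.
move=> j Ej; exists (lift ord_max j); rewrite /attach_leaf liftK.
by case: eqP => [jv|_]; rewrite Ej // jv tE eqxx in at_ *.
Qed.

Variables (G : simple_graph 'I_n) (G' : simple_graph 'I_n.+1).
Hypotheses (G'lift : forall i j, G' (lift ord_max i) (lift ord_max j) = G i j)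
  (G'max : forall j, G' ord_max (lift ord_max j) = (j == v)).

(** The new vertex lies on the same side as v, its only neighbour, so it adds just a zero row or
    column to the cut matrix. *)
Lemma cutrank_merge (S : {set 'I_n}) :
  (cutrank G' [set i | merge_vertex i \in S] <= cutrank G S)%N.
Proof.
have [P [Q PQ]] := cut_factor_cutrank G S.
pose ext (F : 'I_n -> 'I_(cutrank G S) -> 'F_2) i :=
  if unlift ord_max i is Some j then F j else fun=> 0%R.
apply: cutrank_le_factor; exists (ext P), (ext Q) => x y.
rewrite !inE /merge_vertex /ext; case: (unliftP ord_max x) => [i ->|->] /=;
  case: (unliftP ord_max y) => [j ->|->] /=.
- by rewrite G'lift; apply: PQ.
- rewrite adj_sym G'max => iS vS; rewrite big1; last by move=> *; rewrite mulr0.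
  by case: eqP => // iv; rewrite iv (negbTE vS) in iS.
- rewrite G'max => vS jS; rewrite big1; last by move=> *; rewrite mul0r.
  by case: eqP => // iv; rewrite iv vS in jS.
- by move=> ->.
Qed.

Lemma card_attach_leaf u : (#|[set i | attach_leaf i == u]| <= 1)%N.
Proof.
rewrite leqNgt; apply/negP=> /card_gt1P[i [j []]].
rewrite !inE => /eqP iE /eqP jE /eqP; apply.
by apply: attach_leaf_inj; rewrite iE jE.
Qed.

(** Contracting the new leaves to t maps walks to walks; conversely a walk in [T] lifts, and a new
    leaf is reached from t by an edge that is not deleted. *)
Lemma edge_side_attach a b :
  edge_side attach attach_leaf (inl a) (inl b) =
  [set i | merge_vertex i \in edge_side T L a b].
Proof.
apply/setP=> i; rewrite !inE -attach_leaf_proj; move: (attach_leaf i) => u.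
apply/idP/idP.
  pose P u := connect (delete_edge T a b) a (attach_proj u).
  apply: (@connect_invariant _ _ P); first exact: connect0.
  move=> x y _ ax /andP[]; rewrite eq_set2.
  case: x y ax => [x|x] [y|y] //= ax; rewrite /P /=.
    move=> Txy ne; apply: connect_trans ax (connect1 _).
    by rewrite /delete_edge /= Txy eq_set2.
    by move=> /eqP xt _; rewrite -xt.
  by move=> /eqP->.
move=> h; have lift_del x y : delete_edge T a b x y ->
    delete_edge attach (inl a) (inl b) (inl x) (inl y).
  by rewrite /delete_edge /= !eq_set2.
case: u h => [w|c] /= /(connect_attach_inl lift_del) // h.
apply: connect_trans h (connect1 _).
by rewrite /delete_edge /= eqxx eq_set2 /= !andbF.
Qed.

(** Old edges fall under [cutrank_merge]. A new edge cuts off a single vertex, so its cut-rank is at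
    most 1; the vertex forms the side or its complement, depending on the orientation. *)
Lemma attach_width :
  (decomposition_width G' attach attach_leaf <= maxn 1 (decomposition_width G T L))%N.
Proof.
apply/bigmax_leqP => -[x y] /=.
case: x y => [a|b] [c|d] //=.
- move=> Tac; rewrite edge_side_attach leq_max; apply/orP; right.
  apply: leq_trans (cutrank_merge _) _.
  exact: (@leq_bigmax_cond _ (fun e : W * W => T e.1 e.2)
    (fun e => cutrank G (edge_side T L e.1 e.2)) (a, c) Tac).
- move=> /eqP ->; rewrite leq_max; apply/orP; left.
  apply: leq_trans (cutrank_le_cardC _ _) _; apply: leq_trans (card_attach_leaf (inr d)).
  apply/subset_leq_card/subsetP=> i; rewrite !inE; apply: contraNT.
  move: (attach_leaf i) => u ud.
  have lift_del x y : T x y -> delete_edge attach (inl t) (inr d) (inl x) (inl y).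
    by move=> Txy; rewrite /delete_edge /= Txy eq_set2 /= !andbF.
  have [[_ conT] _] : is_tree T by case: rdT.
  case: u ud => [w|c] ud; first by apply: connect_attach_inl (conT t w).
  by apply: connect1; rewrite /delete_edge /= eqxx eq_set2 /= eqxx (negbTE ud).
- move=> /eqP ->; rewrite leq_max; apply/orP; left.
  apply: leq_trans (cutrank_le_card _ _) _; apply: leq_trans (card_attach_leaf (inr b)).
  apply/subset_leq_card/subsetP=> i; rewrite !inE.
  apply: (@connect_invariant _ _ (fun u => u == inr b)) => //.
  move=> x y _ /eqP -> /andP[]; case: y => //= y /eqP ->.
  by rewrite eq_set2 !eqxx.
Qed.

End Attach.

(** Start from a single edge with two leaves and repeatedly attach at the leaf of vertex 0. *)
Lemma rank_decomposition_exists (n : nat) : (2 <= n)%N ->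
  exists (W : finType) (T : simple_graph W) (L : 'I_n -> W), rank_decomposition T L.
Proof.
case: n => [|[|n]] // _; elim: n => [|n [W [T [L rdT]]]]; last first.
  by do 3!eexists; apply: (@attach_decomposition _ T _ _ L ord0 rdT erefl).
have sym : symmetric (fun x y : bool => x != y) by move=> [] [].
have irr : irreflexive (fun x y : bool => x != y) by move=> [].
exists bool, (SimpleGraph sym irr), (fun i : 'I_2 => i == ord0).
have deg t : degree (SimpleGraph sym irr) t = 1%N.
  by rewrite /degree -sum1dep_card big_mkcond big_bool; case: t.
split=> [|||i j|t].
- split.
    split=> [|x y]; first by rewrite card_bool.
    by case: (eqVneq x y) => [->|xy]; [exact: connect0 | apply: connect1].
  by move=> p /andP[_ /card_uniqP <-]; rewrite -card_bool max_card.
- by rewrite card_bool.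
- by move=> t; rewrite deg.
- by case: (unliftP ord0 i) => [i' ->|->]; case: (unliftP ord0 j) => [j' ->|->];
    rewrite ?ord1.
- rewrite deg; apply/codomP; case: t; first by exists ord0.
  by exists ord_max.
Qed.

Local Open Scope ring_scope.
Local Open Scope sesquilinear_scope.

(** * Clifford circuits for graph states *)

Section Circuits.
Variable C : numClosedFieldType.

(** * Tensor products and the Pauli group *)

Lemma sum_bits (m : nat) (F : bits m -> C) :
  \sum_x F (@bit m x) = \sum_(b : bits m) F b.
Proof.
rewrite [RHS](reindex (@bit m)) //=.
by exists enum_rank => ? _; rewrite /bit ?enum_valK ?enum_rankK.
Qed.

Lemma tensorM (m : nat) (h h' : 'I_m -> 'M[C]_2) :
  tensor h *m tensor h' = tensor (fun j => h j *m h' j).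
Proof.
apply/matrixP=> x y; rewrite !mxE.
transitivity (\sum_z \prod_(j < m) (h j (bit x j) (bit z j) * h' j (bit z j) (bit y j))).
  by apply: eq_bigr => z _; rewrite !mxE big_split.
rewrite (sum_bits (fun b => \prod_(j < m) (h j (bit x j) (b j) * h' j (b j) (bit y j)))).
rewrite -(bigA_distr_bigA (fun j c => h j (bit x j) c * h' j c (bit y j))).
by apply: eq_bigr => j _; rewrite mxE.
Qed.

Lemma eq_tensor (m : nat) (h h' : 'I_m -> 'M[C]_2) : h =1 h' -> tensor h = tensor h'.
Proof.
by move=> e; apply/matrixP=> x y; rewrite !mxE; apply: eq_bigr => j _; rewrite e.
Qed.

Lemma tensor1 m : tensor (fun _ : 'I_m => 1%:M) = 1%:M :> oper C m.
Proof.
apply/matrixP=> x y; rewrite !mxE; case: eqVneq => [->|xy].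
  by rewrite big1 // => j _; rewrite mxE eqxx.
have [j bj] : exists j, bit x j != bit y j.
  apply/existsP; apply: contraNT xy; rewrite negb_exists => /forallP h.
  by apply/eqP/enum_val_inj/ffunP => j; apply/eqP; have := h j; rewrite negbK.
by rewrite (bigD1 j) //= mxE (negbTE bj) mul0r.
Qed.

Lemma tensor_scale m (c : 'I_m -> C) h :
  tensor (fun j => c j *: h j) = (\prod_j c j) *: tensor h.
Proof.
by apply/matrixP=> x y; rewrite !mxE -big_split; apply: eq_bigr => j _; rewrite mxE.
Qed.

(** The matrix X^a Z^b. In this form conjugation by Clifford gates acts on the exponents a and b. *)
Definition pauliXZ (a b : bool) : 'M[C]_2 :=
  \matrix_(i, j) if (i != j) == a then (-1) ^+ (b && (j == 1)) else 0.

Lemma ord2P (i : 'I_2) : i = 0 \/ i = 1.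
Proof. by case: i => [[|[|]]] //= p; [left|right]; apply: val_inj. Qed.

Lemma mx2P (A B : 'M[C]_2) :
  A 0 0 = B 0 0 -> A 0 1 = B 0 1 -> A 1 0 = B 1 0 -> A 1 1 = B 1 1 -> A = B.
Proof.
move=> *; apply/matrixP=> i j.
by case: (ord2P i) => ->; case: (ord2P j) => ->.
Qed.

Ltac mx2 := apply: mx2P; rewrite !mxE ?big_ord_recl ?big_ord0 ?mxE /=.

Lemma pauliXZ00 : pauliXZ false false = 1%:M.
Proof. by mx2. Qed.
Lemma pauliXZ10 : pauliXZ true false = pauliX C.
Proof. by mx2. Qed.
Lemma pauliXZ01 : pauliXZ false true = pauliZ C.
Proof. by mx2. Qed.
Lemma pauliXZ11 : pauliXZ true true = - 'i *: pauliY C.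
Proof. by mx2; rewrite ?mulr0 ?mulrN ?mulNr -?expr2 ?sqrCi ?opprK. Qed.

Lemma pauli_group_phase m (P : oper C m) k : pauli_group P -> pauli_group ('i ^+ k *: P).
Proof.
elim: k P => [|k IH] P; first by rewrite expr0 scale1r.
case=> al [h [ha hh ->]]; rewrite exprSr -scalerA; apply: IH.
exists ('i * al), h; split=> //; last by rewrite scalerA.
move: ha; rewrite !inE => /or4P[] /eqP ->;
  by rewrite ?mulr1 ?mulrN ?mulr1 -?expr2 ?sqrCi ?opprK ?eqxx ?orbT.
Qed.

(** The power of i collects the phase of the Pauli operator and one factor i from each Y = i X Z. *)
Lemma pauli_groupP m (P : oper C m) : pauli_group P <->
  exists k a b, P = 'i ^+ k *: tensor (fun j => pauliXZ (a j) (b j)).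
Proof.
split=> [[al [h [ha hh ->]]]|[k [a [b ->]]]].
  have [k ->] : exists k, al = 'i ^+ k.
    move: ha; rewrite !inE => /or4P[] /eqP ->.
    - by exists 0%N.
    - by exists 2%N; rewrite sqrCi.
    - by exists 1%N.
    - by exists 3%N; rewrite exprS sqrCi mulrN1.
  have ex j : exists kab : nat * (bool * bool), h j == 'i ^+ kab.1 *: pauliXZ kab.2.1 kab.2.2.
    move: (hh j); rewrite !inE => /or4P[] /eqP ->.
    - by exists (0%N, (false, false)); rewrite pauliXZ00 scale1r.
    - by exists (0%N, (true, false)); rewrite pauliXZ10 scale1r.
    - exists (1%N, (true, true)); rewrite pauliXZ11 scalerA expr1.
      by rewrite mulrN -expr2 sqrCi opprK scale1r.
    - by exists (0%N, (false, true)); rewrite pauliXZ01 scale1r.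
  exists (k + \sum_j (xchoose (ex j)).1)%N, (fun j => (xchoose (ex j)).2.1),
    (fun j => (xchoose (ex j)).2.2).
  rewrite exprD expr_sum -scalerA -tensor_scale; congr (_ *: _).
  by apply: eq_tensor => j; apply/eqP; have := xchooseP (ex j).
apply: pauli_group_phase.
pose c j : C := if a j && b j then - 'i else 1.
pose h j : 'M[C]_2 := if a j then if b j then pauliY C else pauliX C
            else if b j then pauliZ C else 1%:M.
have -> : tensor (fun j => pauliXZ (a j) (b j)) = (\prod_j c j) *: tensor h.
  rewrite -tensor_scale; apply: eq_tensor => j; rewrite /c /h.
  by case: (a j); case: (b j);
    rewrite ?scale1r ?pauliXZ00 ?pauliXZ01 ?pauliXZ10 ?pauliXZ11.
have [l ->] : exists l, \prod_j c j = 'i ^+ l.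
  have ci j : c j = 'i ^+ (3 * (a j && b j)).
    by rewrite /c; case: (_ && _); rewrite // muln1 exprS sqrCi mulrN1.
  by exists (\sum_j 3 * (a j && b j))%N; rewrite expr_sum; apply: eq_bigr.
apply: pauli_group_phase; exists 1, h; split; rewrite ?inE ?eqxx ?scale1r //.
by move=> j; rewrite /h !inE; case: (a j); case: (b j); rewrite eqxx ?orbT.
Qed.

(** * Hadamard and controlled-Z gates *)

Lemma clifford_involution m (U : oper C m) :
  U ^t* = U -> U *m U = 1%:M ->
  (forall P, pauli_group P -> pauli_group (U *m P *m U)) -> clifford U.
Proof.
(* Conjugation by U is its own inverse, so mapping the Pauli group into itself already makes it
   onto. *)
move=> Us UU cl; split=> [|P]; first by apply/unitarymxP; rewrite Us.
rewrite Us; split=> [hP|[Q hQ ->]]; last exact: cl.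
exists (U *m P *m U); first exact: cl.
by rewrite !mulmxA UU mul1mx -mulmxA UU mulmx1.
Qed.

(** The Hadamard matrix without its normalization, which keeps the square root of 2 out of entrywise
    computations. *)
Definition sign_mx : 'M[C]_2 := \matrix_(i, j) (-1) ^+ ((i == 1) && (j == 1)).
Definition hadamard : 'M[C]_2 := (sqrtC 2)^-1 *: sign_mx.

Lemma sqrtC2V : (sqrtC 2)^-1 * (sqrtC 2)^-1 = 2^-1 :> C.
Proof. by rewrite -invfM -expr2 sqrtCK. Qed.

Lemma hadamard_conj (A B : 'M[C]_2) :
  sign_mx *m A *m sign_mx = 2 *: B -> hadamard *m A *m hadamard = B.
Proof.
rewrite /hadamard -scalemxAl -scalemxAr -scalemxAl scalerA sqrtC2V => ->.
by rewrite scalerA mulVf ?pnatr_eq0 // scale1r.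
Qed.

Lemma hadamardK : hadamard *m hadamard = 1%:M.
Proof.
rewrite -[X in X *m _]mulmx1; apply: hadamard_conj.
by rewrite mulmx1; mx2; rewrite ?expr0 ?expr1; ring.
Qed.

(** Conjugation turns X^a Z^b into Z^a X^b; the sign comes from reordering. *)
Lemma hadamard_pauliXZ a b :
  hadamard *m pauliXZ a b *m hadamard = (-1) ^+ (a && b) *: pauliXZ b a.
Proof.
apply: hadamard_conj.
by case: a; case: b; mx2; rewrite ?big_ord_recl ?big_ord0 ?mxE /= ?expr0 ?expr1; ring.
Qed.

Lemma hadamard_adj : hadamard ^t* = hadamard.
Proof.
have c : ((sqrtC 2)^-1)^* = (sqrtC 2)^-1 :> C.
  by apply: geC0_conj; rewrite invr_ge0 sqrtC_ge0 ler0n.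
by rewrite /hadamard; mx2; rewrite rmorphM /= c ?expr0 ?expr1 ?rmorphN1 ?rmorph1.
Qed.

Lemma tensor_adj m (h : 'I_m -> 'M[C]_2) :
  (tensor h) ^t* = tensor (fun j => h j ^t*).
Proof.
apply/matrixP=> x y; rewrite !mxE rmorph_prod.
by apply: eq_bigr => j _; rewrite !mxE.
Qed.

Lemma hadamard_clifford m : clifford (tensor (fun _ : 'I_m => hadamard)).
Proof.
apply: clifford_involution.
- by rewrite tensor_adj; apply: eq_tensor => j; apply: hadamard_adj.
- by rewrite tensorM -tensor1; apply: eq_tensor => j; apply: hadamardK.
move=> P /pauli_groupP[k [a [b ->]]].
rewrite -scalemxAr -scalemxAl !tensorM; apply: pauli_group_phase.
apply/pauli_groupP; exists (\sum_j 2 * (a j && b j))%N, b, a.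
rewrite expr_sum -tensor_scale; apply: eq_tensor => j.
by rewrite hadamard_pauliXZ exprM sqrCi.
Qed.

Definition cz_phase (b : bits 2) : C := (-1) ^+ (b 0%R * b 1%R)%N.
Definition cz : oper C 2 := diag_mx (\row_x cz_phase (bit x)).

Lemma cz_phaseK b : cz_phase b * cz_phase b = 1.
Proof. by rewrite -expr2 sqrr_sign. Qed.

(** Nonzero entries have i = j + a modulo 2 on each qubit, so i0 i1 + j0 j1 = a0 j1 + a1 j0 + a0 a1
    modulo 2: an X on one qubit puts a Z on the other. *)
Lemma pauliXZ_cz (a0 b0 a1 b1 : bool) (i0 i1 j0 j1 : 'I_2) :
  (-1) ^+ (i0 * i1)%N * (pauliXZ a0 b0 i0 j0 * pauliXZ a1 b1 i1 j1)
    * (-1) ^+ (j0 * j1)%N =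
  (-1) ^+ (a0 && a1) *
    (pauliXZ a0 (b0 (+) a1) i0 j0 * pauliXZ a1 (b1 (+) a0) i1 j1).
Proof.
rewrite !mxE; case: (ord2P i0) => ->; case: (ord2P j0) => ->; case: a0 => //=;
  rewrite ?(mul0r, mulr0) //.
all: case: (ord2P i1) => ->; case: (ord2P j1) => ->; case: a1 => //=;
  rewrite ?(mul0r, mulr0) //.
all: by case: b0; case: b1; rewrite /= ?muln0 ?muln1 ?expr0 ?expr1; ring.
Qed.

Lemma cz_clifford : clifford cz.
Proof.
apply: clifford_involution.
- apply/matrixP=> x y; rewrite !mxE eq_sym; case: eqVneq => [->|_]; last by rewrite rmorph0.
  by rewrite rmorphXn rmorphN1.
- apply/matrixP=> x y; rewrite mul_diag_mx !mxE; case: eqVneq => [->|_].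
    by rewrite !mulr1n cz_phaseK.
  by rewrite mulr0.
move=> P /pauli_groupP[k [a [b ->]]].
rewrite -scalemxAr -scalemxAl; apply: pauli_group_phase.
(* In ['I_2], [1 - j] is the other qubit. *)
apply/pauli_groupP; exists (2 * (a 0%R && a 1%R))%N, a, (fun j => b j (+) a (1 - j)).
rewrite exprM sqrCi; apply/matrixP=> x y.
rewrite mul_diag_mx mul_mx_diag !mxE !big_ord_recl !big_ord0 !mulr1.
rewrite (_ : lift _ _ = 1); last exact: val_inj.
by rewrite subr0 subrr -pauliXZ_cz.
Qed.

(** * Product states and circuits *)

Definition product_state m (g : 'I_m -> 'I_2 -> C) : state C m :=
  \col_x \prod_i g i (bit x i).

Lemma eq_product_state m (g g' : 'I_m -> 'I_2 -> C) :
  (forall i, g i =1 g' i) -> product_state g = product_state g'.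
Proof.
by move=> e; apply/matrixP=> x y; rewrite !mxE; apply: eq_bigr => i _; rewrite e.
Qed.

Lemma gate1_product_state m (j : 'I_m) (h : 'M[C]_2) (g : 'I_m -> 'I_2 -> C) :
  on_qubits (fun _ : 'I_1 => j) (tensor (fun _ => h)) *m product_state g =
  product_state (fun i b => if i == j then \sum_c h b c * g j c else g i b).
Proof.
apply/matrixP=> x z; rewrite !mxE.
(* The condition in [on_qubits] becomes a Kronecker delta on each qubit other than j, so the sum
   over basis states factors into one sum per qubit. *)
pose F i c := if i == j then h (bit x j) c * g j c
              else (bit x i == c)%:R * g i c.
transitivity (\sum_y \prod_i F i (@bit m y i)).
  apply: eq_bigr => y _; rewrite !mxE.
  case: ifP => [/forallP cond|/negbT].
    rewrite big_ord1 /bit !enum_rankK !ffunE -!/(bit _).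
    rewrite [in LHS](bigD1 j) //= [in RHS](bigD1 j) //= mulrA /F eqxx.
    congr (_ * _); apply: eq_bigr => i ij; rewrite (negbTE ij).
    have /implyP/(_ _)/eqP -> := cond i; first by rewrite eqxx mul1r.
    by apply/negP=> /codomP[_ E]; rewrite E eqxx in ij.
  rewrite negb_forall => /existsP[ i ]; rewrite negb_imply => /andP[ij xy].
  rewrite mul0r (bigD1 i) //= /F ifN ?(negbTE xy) ?mul0r //.
  by apply: contra ij => /eqP ->; apply/codomP; exists 0.
rewrite (sum_bits (fun b : bits m => \prod_i F i (b i))) -(bigA_distr_bigA F).
apply: eq_bigr => i _; rewrite /F; case: (eqVneq i j) => [->|ij] //.
rewrite (bigD1 (bit x i)) //= eqxx mul1r big1 ?addr0 // => c.
by rewrite eq_sym => /negbTE ->; rewrite mul0r.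
Qed.

Definition ket0 (b : 'I_2) : C := (b == 0)%:R.
Definition ket_plus (b : 'I_2) : C := (sqrtC 2)^-1.

Lemma zero_stateE m : zero_state C m = product_state (fun _ => ket0).
Proof.
apply/matrixP=> x y; rewrite !mxE; case: eqP => [->|/eqP ne].
  by rewrite big1 // => i _; rewrite ffunE.
have [i xi] : exists i, bit x i != 0.
  apply/existsP; apply: contraNT ne; rewrite negb_exists => /forallP h.
  by apply/eqP/ffunP => i; rewrite ffunE; apply/eqP; rewrite -[_ == _]negbK.
by rewrite (bigD1 i) //= /ket0 (negbTE xi) mul0r.
Qed.

(** Gates are prepended, so the induction runs backwards in time: [s] lists the qubits still in
    |0>. *)
Lemma hadamard_circuit n m (phi : state C n) (A : algorithm C n m) (s : seq 'I_m) :
  uniq s -> generates phi A (product_state (fun _ => ket_plus)) ->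
  exists A' : algorithm C n m, cz_complexity A' = cz_complexity A /\
    generates phi A' (product_state (fun i => if i \in s then ket0 else ket_plus)).
Proof.
move=> us gA; elim: s us => [|j s IH] /=; first by exists A.
case/andP=> js /IH[A' [<- gA']].
exists (Gate1 j (hadamard_clifford 1) A'); split=> //=.
rewrite gate1_product_state; congr (generates phi A' _): gA'.
apply: eq_product_state => i b; rewrite !in_cons eqxx; case: (eqVneq i j) => [->|_] //=.
rewrite (negbTE js) !big_ord_recl big_ord0 /ket0 /= mulr1 mulr0 !addr0.
by rewrite /hadamard !mxE andbF mulr1.
Qed.

Definition edge_phase m (es : seq ('I_m * 'I_m)) (b : bits m) : C :=
  \prod_(e <- es) (-1) ^+ (b e.1 * b e.2)%N.

Lemma cz_gate m (j k : 'I_m) (f : bits m -> C) : j != k ->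
  on_qubits (fun i : 'I_2 => if i == 0 then j else k) cz *m (\col_x f (bit x)) =
  \col_x ((-1) ^+ (bit x j * bit x k)%N * f (bit x)).
Proof.
move=> jk; apply/matrixP=> x z; rewrite !mxE (bigD1 x) //= big1 ?addr0 => [|y yx].
  rewrite !mxE ifT; last by apply/forallP=> i; rewrite eqxx implybT.
  by rewrite eqxx mulr1n /cz_phase /bit enum_rankK !ffunE.

rewrite !mxE; case: ifP => [/forallP cond|]; last by rewrite mul0r.
case: eqP => [/enum_rank_inj /ffunP E|]; last by rewrite mulr0n mul0r.
case/eqP: yx; apply/enum_val_inj/ffunP => i; apply/esym.
have := cond i; case: codomP => [[l ->]|_ /eqP //] _.
by have := E l; rewrite !ffunE.
Qed.

(** One algorithm must serve all f, because the induction hypothesis is applied to f times the sign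
    of the first edge. *)
Lemma cz_circuit n m (phi : state C n) (A : algorithm C n m) es :
  all (fun e : 'I_m * 'I_m => e.1 != e.2) es ->
  exists A' : algorithm C n m, cz_complexity A' = (size es + cz_complexity A)%N /\
    forall f : bits m -> C,
      generates phi A (\col_x (edge_phase es (bit x) * f (bit x))) ->
      generates phi A' (\col_x f (bit x)).
Proof.
elim: es => [|e es IH] /=.
  move=> _; exists A; split=> // f; congr (generates phi A _).
  by apply/matrixP=> x y; rewrite !mxE /edge_phase big_nil mul1r.
case/andP=> e12 /IH[A' [cA' gA']].
exists (Gate2 e12 cz_clifford A'); split=> [|f h] /=; first by rewrite cA'.
rewrite cz_gate //; apply: (gA' (fun b => (-1) ^+ (b e.1 * b e.2)%N * f b)).
congr (generates phi A _): h; apply/matrixP=> x y; rewrite !mxE.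
by rewrite /edge_phase big_cons mulrA (mulrC (_ ^+ _)).
Qed.

(** * Amplitudes of graph states *)

Definition edges n (G : simple_graph 'I_n) : seq ('I_n * 'I_n) :=
  enum [pred p : 'I_n * 'I_n | (p.1 < p.2)%N && G p.1 p.2].

(** The normalization 2^(-n/2) is written as a product over qubits, which makes it the amplitude of
    the product of |+> states. *)
Definition graph_amp n (G : simple_graph 'I_n) (b : bits n) : C :=
  edge_phase (edges G) b * \prod_(i < n) (sqrtC 2)^-1.

Definition flip n (v : 'I_n) (b : bits n) : bits n :=
  [ffun w => if w == v then b w + 1 else b w].

(** Flipping bit v changes the sign of an edge vw by (-1)^(b w) and leaves edges away from v
    alone. *)
Lemma edge_phase_flip n (G : simple_graph 'I_n) (v : 'I_n) (b : bits n) :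
  (\prod_w if G v w then (-1) ^+ b w else 1) * edge_phase (edges G) (flip v b) =
  edge_phase (edges G) b.
Proof.
pose s w : C := (-1) ^+ b w.
pose P (i j : 'I_n) := (i < j)%N && G i j.
(* Each neighbour w of v corresponds to one listed edge, with v as its first or second end according
   to the order of v and w. *)
have split_edges : \prod_w (if G v w then s w else 1) =
    \prod_(e | P e.1 e.2) ((if e.1 == v then s e.2 else 1) *
                          (if e.2 == v then s e.1 else 1)).
  have pick (Q : rel 'I_n) (w : 'I_n) (F : 'I_n -> C) :
      \prod_i \prod_(j | Q i j) (if i == w then F j else 1) = \prod_(j | Q w j) F j.
    rewrite (bigD1 w) //= [X in _ * X]big1 ?mulr1 => [|i iw].
      by apply: eq_bigr => j _; rewrite eqxx.
    by rewrite big1 // => j _; rewrite (negbTE iw).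
  rewrite big_split /=.
  rewrite -(pair_big_dep xpredT P (fun i j => if i == v then s j else 1)) /= pick.
  rewrite -(pair_big_dep xpredT P (fun i j => if j == v then s i else 1)) /=.
  rewrite [X in _ = _ * X](exchange_big_dep xpredT) //= (pick (fun j i => P i j)).
  rewrite [X in _ = X * _]big_mkcond [X in _ = _ * X]big_mkcond -big_split.
  apply: eq_bigr => w _; rewrite /P adj_sym; case: ltngtP => [||/val_inj ->] /=.
  - by rewrite mulr1.
  - by rewrite mul1r.
  - by rewrite adj_irr mul1r.
rewrite split_edges /edge_phase /edges !big_enum -big_split /=.
apply: eq_bigr => -[i j] /= /andP[ij _].
have {ij} ij : i != j by apply: contraTneq ij => ->; rewrite ltnn.
rewrite /s !ffunE; case: (eqVneq i v) => [iv|_]; case: (eqVneq j v) => [jv|_].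
- by rewrite iv jv eqxx in ij.
- by case: (ord2P (b i)) => ->; case: (ord2P (b j)) => ->; rewrite /= ?expr0 ?expr1; ring.
- by case: (ord2P (b i)) => ->; case: (ord2P (b j)) => ->; rewrite /= ?expr0 ?expr1; ring.
- by rewrite !mul1r.
Qed.

(** All 2^n amplitudes have squared modulus 2^(-n). Row x of the stabilizer of v has its only
    nonzero entry in column [flip v x], with the product of Z signs that [edge_phase_flip]
    cancels. *)
Lemma graph_stateP n (G : simple_graph 'I_n) :
  is_graph_state G (\col_x graph_amp G (bit x)).
Proof.
split.
  rewrite /norm2 (eq_bigr (fun=> \prod_(i < n) 2^-1)); last first.
    move=> x _; rewrite mxE /graph_amp normrM exprMn -[RHS]mul1r; congr (_ * _).
      rewrite normr_prod big1 ?expr1n // => e _.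
      by rewrite normrX normrN1 expr1n.
    rewrite normr_prod -prodrXl; apply: eq_bigr => i _.
    by rewrite ger0_norm ?invr_ge0 ?sqrtC_ge0 ?ler0n // expr2 sqrtC2V.
  rewrite !prodr_const sumr_const card_ord card_ffun !card_ord.
  by rewrite -[LHS]mulr_natr natrX -exprMn mulVf ?pnatr_eq0 // expr1n.
move=> v; apply/matrixP=> x z; rewrite !mxE.
pose h w : 'M[C]_2 := if w == v then pauliX C else if G v w then pauliZ C else 1%:M.
pose F (b : bits n) := (\prod_w h w (bit x w) (b w)) * graph_amp G b.
transitivity (\sum_y F (@bit n y)); first by apply: eq_bigr => y _; rewrite !mxE.
rewrite sum_bits /F (bigD1 (flip v (bit x))) //= [X in _ + X]big1 ?addr0 => [|b bx].
  rewrite /graph_amp mulrA -[in RHS](edge_phase_flip G v).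

  congr (_ * _ * _).
  apply: eq_bigr => w _; rewrite ffunE /h; case: (eqVneq w v) => [->|wv].
    by rewrite adj_irr mxE; case: (ord2P (bit x v)) => ->.
  by case: (G v w); rewrite mxE eqxx.
have [w bw] : exists w, b w != flip v (bit x) w.
  apply/existsP; apply: contraNT bx; rewrite negb_exists => /forallP e.
  by apply/eqP/ffunP => w; apply/eqP; rewrite -[_ == _]negbK.
rewrite (bigD1 w) //= (_ : h w _ _ = 0) ?mul0r //.
move: bw; rewrite ffunE /h; case: (w =P v) => _; last first.
  by rewrite eq_sym => /negbTE bw; case: (G v w); rewrite mxE bw.
by rewrite mxE; case: (ord2P (bit x w)) => ->; case: (ord2P (b w)) => ->.
Qed.

Lemma graph_state_algorithm n (G : simple_graph 'I_n) :
  exists A : algorithm C n n,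
    generates (\col_x graph_amp G (bit x)) A (zero_state C n) /\
    cz_complexity A = size (edges G).
Proof.
set phi := \col_x _.
have gen0 : generates phi (Done C n) phi by exists 1; rewrite ?normr1 ?scale1r.
have [|A1 [c1 g1]] := @cz_circuit n n phi (Done C n) (edges G).
  by apply/allP=> e; rewrite mem_enum => /andP[+ _]; apply: contraTneq => ->; rewrite ltnn.
have [||A2 [c2 g2]] := @hadamard_circuit n n phi A1 (enum 'I_n).
- exact: enum_uniq.
- exact: (g1 (fun b => \prod_(i < n) (sqrtC 2)^-1)).
exists A2; split; last by rewrite c2 c1 addn0.
rewrite zero_stateE; congr (generates phi A2 _): g2.
by apply: eq_product_state => i; rewrite mem_enum.
Qed.

End Circuits.

(** * The core joined to a universal vertex *)

Lemma is_minimum_exists (S : nat -> Prop) : (exists k, S k) -> exists k, is_minimum S k.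
Proof.
move=> exS; have ex : exists k, `[< S k >] by case: exS => k Sk; exists k; apply/asboolP.
case: (ex_minnP ex) => k /asboolP Sk kmin; exists k; split=> // j Sj.
by apply: kmin; apply/asboolP.
Qed.

Section Hub.
Variables (es : seq (nat * nat)).

(** Core edges are pairs of natural numbers, so one list serves for every n; it may contain loops
    and both orientations of an edge. *)
Definition hub_rel n : rel 'I_n := fun i j =>
  (i != j) && [|| i == 0%N :> nat, j == 0%N :> nat,
                (val i, val j) \in es | (val j, val i) \in es].

Lemma hub_sym n : symmetric (@hub_rel n).
Proof.
move=> i j; rewrite /hub_rel eq_sym; congr (_ && _).
by rewrite orbCA; congr [|| _, _ | _]; rewrite orbC.
Qed.

Lemma hub_irr n : irreflexive (@hub_rel n).
Proof. by move=> i; rewrite /hub_rel eqxx. Qed.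

Definition hub_graph n : simple_graph 'I_n := SimpleGraph (@hub_sym n) (@hub_irr n).

Lemma hub_connected n : (0 < n)%N -> connected_graph (hub_graph n).
Proof.
case: n => // n _; split; first by rewrite card_ord.
have tot x : connect (hub_graph n.+1) ord0 x.
  case: (eqVneq ord0 x) => [<- //|ne]; apply: connect1.
  by rewrite /= /hub_rel ne.
move=> x y; apply: connect_trans (tot y).
by rewrite sym_connect_sym // => ? ?; apply: adj_sym.
Qed.

Lemma card_nat_pairs n (P : pred ('I_n * 'I_n)) (s : seq (nat * nat)) :
  (forall p, P p -> (val p.1, val p.2) \in s) -> (#|P| <= size s)%N.
Proof.
move=> h; rewrite cardE -(size_map (fun p : 'I_n * 'I_n => (val p.1, val p.2))).
apply: uniq_leq_size.
  rewrite map_inj_uniq ?enum_uniq // => -[a b] [a' b'] [E E'].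
  by congr (_, _); apply: val_inj.
by move=> p /mapP[q]; rewrite mem_enum => /h hq ->.
Qed.

Lemma size_edges_hub n : (size (edges (hub_graph n)) <= n.-1 + size es)%N.
Proof.
(* The pairs of [es] are sorted because [edges] puts the smaller end first. *)
pose s := [seq (0%N, j) | j <- iota 1 n.-1] ++
          [seq (minn e.1 e.2, maxn e.1 e.2) | e <- es].
have -> : (n.-1 + size es = size s)%N by rewrite size_cat !size_map size_iota.
rewrite -cardE; apply: card_nat_pairs => -[i j] /= /andP[ij /andP[_ h]].
rewrite mem_cat; case: (posnP (val i)) => [i0|i0].
  apply/orP; left; rewrite i0; apply/mapP; exists (val j) => //.
  by rewrite mem_iota /=; have := ltn_ord j; lia.
apply/orP; right; apply/mapP; move: h; rewrite gtn_eqF // gtn_eqF; last exact: leq_trans ij.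
have [mn mx] : minn i j = i /\ maxn i j = j by lia.
move=> /= /orP[] h; [exists (val i, val j)|exists (val j, val i)].
- exact: h.
- by rewrite /= mn mx.
- exact: h.
- by rewrite /= minnC maxnC mn mx.
Qed.

Variable (N : nat).
Hypothesis (esN : forall e, e \in es -> (e.1 < N)%N /\ (e.2 < N)%N).

Definition core n : {set 'I_n} := [set i : 'I_n | (i < N)%N].

Lemma hub_core_pairs n :
  (#|[set p : 'I_n * 'I_n | [&& p.1 \in core n, p.2 \in core n & hub_graph n p.1 p.2]]|
   <= 2 * N + 2 * size es)%N.
Proof.
pose s := [seq (0%N, j) | j <- iota 0 N] ++ [seq (j, 0%N) | j <- iota 0 N] ++
          es ++ [seq (e.2, e.1) | e <- es].
have -> : (2 * N + 2 * size es = size s)%N.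
  by rewrite !size_cat !size_map size_iota; lia.
rewrite cardsE; apply: card_nat_pairs => -[i j] /=; rewrite !inE.
move=> /and3P[iN jN /andP[_ h]]; rewrite !mem_cat; case/or4P: h => h.
- by apply/or4P/Or41/mapP; exists (val j); rewrite ?mem_iota // (eqP h).
- by apply/or4P/Or42/mapP; exists (val i); rewrite ?mem_iota // (eqP h).
- exact/or4P/Or43.
- by apply/or4P/Or44/mapP; exists (val j, val i).
Qed.

Lemma hub_lift n (i j : 'I_n) :
  hub_graph n.+1 (lift ord_max i) (lift ord_max j) = hub_graph n i j.
Proof. by rewrite /= /hub_rel (inj_eq (@lift_inj _ _)) /= /bump !(leqNgt n) !ltn_ord. Qed.

(** The new vertex has number n >= N, beyond all entries of [es], so it is adjacent to the hub 0
    alone. *)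
Lemma hub_max n (v : 'I_n) : (0 < N <= n)%N -> v = 0%N :> nat -> forall j : 'I_n,
  hub_graph n.+1 ord_max (lift ord_max j) = (j == v).
Proof.
move=> /andP[N0 Nn] v0 j; rewrite /= /hub_rel neq_lift !lift_max /=.
have n0 : (0 < n)%N by apply: leq_trans Nn.
rewrite gtn_eqF // -val_eqE /= v0; case: eqP => //= _.
by apply/negbTE; rewrite negb_or; apply/andP; split; apply/negP => /esN [/= a b]; lia.
Qed.

(** Attach at the leaf of vertex 0; positivity of r absorbs the 1 in [attach_width]. *)
Lemma hub_width_step n r : (0 < N <= n)%N -> (0 < r)%N ->
  (exists (W : finType) (T : simple_graph W) (L : 'I_n -> W),
    rank_decomposition T L /\ (decomposition_width (hub_graph n) T L <= r)%N) ->
  exists (W : finType) (T : simple_graph W) (L : 'I_n.+1 -> W),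
    rank_decomposition T L /\ (decomposition_width (hub_graph n.+1) T L <= r)%N.
Proof.
move=> Nn r0 [W [T [L [rdT wT]]]].
have n0 : (0 < n)%N by case/andP: Nn => ?; apply: leq_trans.
pose v := Ordinal n0.
exists _, (attach T (L v)), (attach_leaf L v); split; first exact: attach_decomposition.
have := attach_width rdT erefl (@hub_lift n) (@hub_max n v Nn erefl).
by move=> /leq_trans; apply; rewrite geq_max r0.
Qed.

Variables (k D : nat).
Hypotheses (k0 : (0 < k)%N) (NE : N = (8 * k)%N)
  (sparse : (2 * N + 2 * size es < D * k)%N)
  (dense : forall A B : {set 'I_N}, (k <= #|A|)%N -> (k <= #|B|)%N ->
    exists x y : 'I_N, [/\ x \in A, y \in B & (val x, val y) \in es]).

Lemma hub_width n (W : finType) (T : simple_graph W) (L : 'I_n -> W) :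
  (N <= n)%N -> rank_decomposition T L ->
  (k < D * decomposition_width (hub_graph n) T L)%N.
Proof.
move=> Nn rdT.
have widen_inj : injective (widen_ord Nn) by move=> i j [] /val_inj.
have inCore i : i \in core n -> exists j : 'I_N, i = widen_ord Nn j.
  by rewrite inE => iN; exists (Ordinal iN); apply: val_inj.
have cardK : #|core n| = (8 * k)%N.
  rewrite -NE -[RHS]card_ord -(card_imset _ widen_inj); apply: eq_card => i.
  rewrite inE; apply/idP/imsetP => [iN|[j _ ->]]; last exact: (ltn_ord j).
  by exists (Ordinal iN) => //; apply: val_inj.
have [a [b [Tab [ca cb]]]] := balanced_edge rdT k0 cardK.
have lb : (k < D * cutrank (hub_graph n) (edge_side T L a b))%N.
  apply: (cutrank_lower_bound (K := core n)) => //; last first.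
    exact: leq_ltn_trans (hub_core_pairs n) sparse.
  move=> A B AK BK AB Ak Bk.
  (* Subsets of the core are pulled back to ['I_N], where [dense] applies. *)
  have pre (X : {set 'I_n}) : X \subset core n -> (k <= #|X|)%N ->
      (k <= #|[set i | widen_ord Nn i \in X]|)%N.
    move=> /subsetP XK kX; apply: leq_trans kX _.
    rewrite -(card_imset _ widen_inj); apply/subset_leq_card/subsetP => i iX.
    have [j E] := inCore _ (XK _ iX); apply/imsetP; exists j => //.
    by rewrite inE -E.
  have [x [y [xA yB xy]]] := dense (pre A AK Ak) (pre B BK Bk).
  rewrite !inE in xA yB; exists (widen_ord Nn x), (widen_ord Nn y); split=> //.
  (* The pair found is not a loop, since A and B are disjoint. *)
  rewrite /= /hub_rel /= xy !orbT andbT; apply: contraTneq xA => ->.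
  by rewrite (disjointFl AB yB).
apply: leq_trans lb _; rewrite leq_mul2l; apply/orP; right.
exact: (@leq_bigmax_cond _ (fun e : W * W => T e.1 e.2)
  (fun e => cutrank (hub_graph n) (edge_side T L e.1 e.2)) (a, b) Tab).
Qed.

Lemma hub_rank_width : exists n' r : nat, [/\ (k < D * r)%N, (2 <= n')%N &
  forall n, (n' <= n)%N -> is_rank_width (hub_graph n) r].
Proof.
have N2 : (2 <= N)%N by rewrite NE; lia.
(* Take the least width r occurring for any n >= N, and n' where it occurs. From n' on,
   [hub_width_step] keeps width r attainable, and minimality over all n excludes smaller widths. *)
pose Q r := exists2 n, (N <= n)%N &
  exists (W : finType) (T : simple_graph W) (L : 'I_n -> W),
    rank_decomposition T L /\ (decomposition_width (hub_graph n) T L <= r)%N.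
have [r [[n' Nn' dec] rmin]] : exists r, is_minimum Q r.
  apply: is_minimum_exists; have [W [T [L rdT]]] := rank_decomposition_exists N2.
  by exists (decomposition_width (hub_graph N) T L), N => //; exists W, T, L.
have kr : (k < D * r)%N.
  have [W [T [L [rdT wr]]]] := dec; apply: leq_trans (hub_width Nn' rdT) _.
  by rewrite leq_mul2l wr orbT.
have r0 : (0 < r)%N by case: (r) kr; rewrite ?muln0.
exists n', r; split=> [//||n n'n]; first exact: leq_trans Nn'.
have {}dec : exists (W : finType) (T : simple_graph W) (L : 'I_n -> W),
    rank_decomposition T L /\ (decomposition_width (hub_graph n) T L <= r)%N.
  elim: n n'n => [|n IH]; first by rewrite leqn0 => /eqP E; rewrite -E.
  rewrite leq_eqVlt => /orP[/eqP <- //|n'n]; apply: hub_width_step (IH n'n) => //.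
  by rewrite (leq_trans _ N2) //= (leq_trans Nn').
have Nn : (N <= n)%N by apply: leq_trans n'n.
rewrite /is_rank_width card_ord leqNgt (leq_trans N2 Nn) /=; split.
  have [W [T [L [rdT wr]]]] := dec; exists W, T, L; split=> //.
  by apply/eqP; rewrite eqn_leq wr; apply: rmin; exists n => //; exists W, T, L.
move=> j [W [T [L [rdT <-]]]]; apply: rmin.
by exists n => //; exists W, T, L.
Qed.

End Hub.

Theorem lemma8 (R : realType) :
  exists c : R, 1 <= c /\
  forall r' : nat, (0 < r')%N ->
  exists n' r : nat, (r' <= r)%N /\
  forall n : nat, (n' <= n)%N ->
  exists G : simple_graph 'I_n,
    [/\ connected_graph G, is_rank_width G r &
      exists (psi : state (complex R) n) (g : nat),
        [/\ is_graph_state G psi, is_GammaCZ psi g &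
            g%:R <= n%:R - 1 + c * (r%:R - 1)]].
Proof.
have [d core_edges] := random_edges.
(* The core has at most 2 N + 2 d N = 16 (d + 1) k ordered adjacent pairs, so this D makes it sparse
   enough. *)
pose D := (16 * d.+1).+1.
exists (16 * d * D).+1%:R; split; first by rewrite ler1n.
(* With this k, the bound k < D r gives r > r' + 1, so in particular r >= 2. *)
move=> r' r'0; pose k := (D * r'.+1)%N.
have k0 : (0 < k)%N by [].
have [e eP] := core_edges k k0.
pose es := [seq (val (e m).1, val (e m).2) | m : 'I_(d * (8 * k))].
have size_es : size es = (d * (8 * k))%N by rewrite size_map -cardE card_ord.
have esN : forall p, p \in es -> (p.1 < 8 * k)%N /\ (p.2 < 8 * k)%N.
  by move=> p /mapP[m _ ->]; split; apply: ltn_ord.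
have sparse : (2 * (8 * k) + 2 * size es < D * k)%N.
  by rewrite size_es /D; move: (k) k0 => K K0; nia.
have dense (A B : {set 'I_(8 * k)}) : (k <= #|A|)%N -> (k <= #|B|)%N ->
    exists x y, [/\ x \in A, y \in B & (val x, val y) \in es].
  move=> hA hB; have [m [mA mB]] := eP A B hA hB.
  by exists (e m).1, (e m).2; split=> //; apply/mapP; exists m; rewrite ?mem_enum.
have [n' [r [kr n'2 rw]]] := hub_rank_width esN k0 erefl sparse dense.
have r'r : (r'.+1 < r)%N by move: kr; rewrite /k ltn_mul2l.
exists n', r; split=> [|n n'n]; first by lia.
have n0 : (0 < n)%N by lia.
exists (hub_graph es n); split; [exact: hub_connected | exact: rw|].
exists (\col_x graph_amp (complex R) (hub_graph es n) (bit x)).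
have [A [genA cA]] := graph_state_algorithm (complex R) (hub_graph es n).
set phi := \col_x _ in genA *.
have ex : exists s (A' : algorithm (complex R) n (n + s)),
    generates phi A' (zero_state (complex R) (n + s)) /\
    cz_complexity A' = size (edges (hub_graph es n)).
  by exists 0%N; rewrite addn0; exists A.
have [g gE] : exists g, is_GammaCZ phi g.
  by apply: is_minimum_exists; exists (size (edges (hub_graph es n))).
exists g; split; [exact: graph_stateP | exact: gE|].
have : (g <= n.-1 + (16 * d * D).+1 * r.-1)%N.
  apply: leq_trans (proj2 gE _ ex) _; apply: leq_trans (size_edges_hub es n) _.
  rewrite leq_add2l size_es; apply: (@leq_trans (16 * d * D * r.-1)); last first.
    by rewrite leq_mul2r leqnSn orbT.
  (* As r >= 2, r is at most 2 (r - 1); so the 8 d k core edges number at most 16 d D (r - 1). The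
     extra 1 in c ensures c >= 1. *)
  have kle : (k <= D * (2 * r.-1))%N.
    by apply: leq_trans (ltnW kr) _; rewrite leq_mul2l; apply/orP; right; lia.
  apply: (@leq_trans (d * (8 * (D * (2 * r.-1))))); first by rewrite leq_mul2l leq_mul2l kle !orbT.
  by move: (D) (r.-1) => D' q; lia.
have predE m : (0 < m)%N -> m%:R - 1 = m.-1%:R :> R.
  by case: m => // m _; rewrite -natr1 addrK.
rewrite !predE ?(leq_trans _ r'r) //.
by rewrite -natrM -natrD ler_nat.
Qed.
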